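(* Let $\mathcal M=(M,<,+,\cdot,\ldots)$ be an o-minimal expansion of a real closed field. Let $G$ be a definable group, equipped with its definable manifold topology, and let $H<G$ be a definable subgroup (not necessarily normal). Let $\tau$ be a topology on $G/H$ such that $(G/H,\tau)$ is a definable manifold and the action $L\colon G\times G/H\to G/H$, $L(g_1,g_2H)=g_1g_2H$, is continuous. Then $\tau$ coincides with the quotient topology $\nu$ on $G/H$ induced by the projection $G\to G/H$. Moreover, if $H$ is normal in $G$, then the definable manifold topology of the definable group $G/H$ also coincides with $\nu$ (and hence with $\tau$).
   Context: ''Definable'' means first-order definable in $\mathcal M$ with parameters. A definable manifold of dimension $n$ is a definable set $X$ with a topology admitting a finite cover by definable open sets $U_i$ and definable homeomorphisms of the $U_i$ onto open subsets of $M^n$ ($M$ with the order topology). A definable group is a definable set with a definable group operation; it has a unique topology (its definable manifold topology) making it a topological group and a definable manifold of dimension $\dim G$. By definable choice $G/H$ is identified with a definable set (via a definable map $\iota$ on $G$ with $\iota(g)=\iota(h)$ iff $gH=hH$). A topology $\tau$ as in the statement exists. *)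

(* Defs.v *)
From HB Require Import structures.
From mathcomp Require Import all_boot all_order all_algebra.
From mathcomp Require Import boolp classical_sets topology normedtype.
Set Implicit Arguments. Unset Strict Implicit. Unset Printing Implicit Defensive.
Import Order.TTheory GRing.Theory Num.Theory.
Import numFieldTopology.Exports.
Local Open Scope classical_set_scope.
Local Open Scope ring_scope.

(* An o-minimal structure on the real closed field R, in the sense of
   van den Dries: a family (S_n) of subsets of R^n (here 'rV[R]_n) that is a
   boolean algebra, closed under cartesian products and coordinate
   projections, contains the diagonals, all points (parameters), the graphs of
   + and * and the order relation, and such that every set in S_1 is a finite
   union of intervals.  These are exactly the families of sets definable with
   parameters in an o-minimal expansion of (R,<,+,.). *)
#[local] Unset Implicit Arguments.
Record ostructure (R : rcfType) := OStructure {
  Sdef : forall n, set (set 'rV[R]_n);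
  Sdef_setT : forall n, Sdef n setT;
  Sdef_setU : forall n (A B : set 'rV[R]_n), Sdef n A -> Sdef n B -> Sdef n (A `|` B);
  Sdef_setC : forall n (A : set 'rV[R]_n), Sdef n A -> Sdef n (~` A);
  Sdef_prod : forall n m (A : set 'rV[R]_n) (B : set 'rV[R]_m),
     Sdef n A -> Sdef m B ->
     Sdef (n + m) [set z | exists a b, [/\ A a, B b & z = row_mx a b]];
  Sdef_diag : forall n (i j : 'I_n), Sdef n [set x | x ord0 i = x ord0 j];
  Sdef_proj : forall n m (A : set 'rV[R]_(n + m)),
     Sdef (n + m) A -> Sdef n [set x | exists y : 'rV[R]_m, A (row_mx x y)];
  Sdef_pt : forall a : R, Sdef 1 [set x | x ord0 ord0 = a];
  Sdef_add : Sdef 3 [set x | x ord0 (inord 0) + x ord0 (inord 1) = x ord0 (inord 2)];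
  Sdef_mul : Sdef 3 [set x | x ord0 (inord 0) * x ord0 (inord 1) = x ord0 (inord 2)];
  Sdef_lt : Sdef 2 [set x | x ord0 (inord 0) < x ord0 (inord 1)];
  Sdef_omin : forall A : set 'rV[R]_1, Sdef 1 A ->
     exists s : seq (interval R), A = [set x | has (fun I => x ord0 ord0 \in I) s]
}.
#[local] Set Implicit Arguments.
Arguments Sdef {R} o {n}.

Section Defs.
Variables (R : rcfType) (S : ostructure R).

Definition definable n (A : set 'rV[R]_n) := Sdef S A.

Definition definable_fun n m (X : set 'rV[R]_n) (f : 'rV[R]_n -> 'rV[R]_m) :=
  Sdef S [set z | exists x, X x /\ z = row_mx x (f x)].

Definition is_topology n (X : set 'rV[R]_n) (opn : set (set 'rV[R]_n)) :=
  [/\ opn set0, opn X, (forall U, opn U -> U `<=` X),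
      (forall U V, opn U -> opn V -> opn (U `&` V)) &
      (forall F : set (set 'rV[R]_n), F `<=` opn -> opn (\bigcup_(U in F) U))].

Definition def_manifold n (X : set 'rV[R]_n) (opn : set (set 'rV[R]_n)) (d : nat) :=
  [/\ definable X, is_topology X opn &
   exists (p : nat) (U : 'I_p -> set 'rV[R]_n) (phi : 'I_p -> 'rV[R]_n -> 'rV[R]_d),
     X = \bigcup_(i in setT) U i /\
     forall i, [/\ opn (U i), definable (U i), definable_fun (U i) (phi i) &
       [/\ (forall x y, U i x -> U i y -> phi i x = phi i y -> x = y),
            open (phi i @` U i) &
            (forall A, A `<=` U i -> (opn A <-> open (phi i @` A)))]]].

Definition def_group n (G : set 'rV[R]_n) (mul : 'rV[R]_n -> 'rV[R]_n -> 'rV[R]_n)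
    (inv : 'rV[R]_n -> 'rV[R]_n) (e : 'rV[R]_n) :=
  [/\ definable G,
      definable_fun [set z : 'rV[R]_(n + n) | G (lsubmx z) /\ G (rsubmx z)]
                    (fun z => mul (lsubmx z) (rsubmx z)),
      definable_fun G inv,
      [/\ G e, (forall g h, G g -> G h -> G (mul g h)) & (forall g, G g -> G (inv g))] &
      [/\ (forall g h l, G g -> G h -> G l -> mul (mul g h) l = mul g (mul h l)),
          (forall g, G g -> mul e g = g /\ mul g e = g) &
          (forall g, G g -> mul (inv g) g = e /\ mul g (inv g) = e)]].

Definition def_subgroup n (G H : set 'rV[R]_n) mul (inv : 'rV[R]_n -> 'rV[R]_n) e :=
  [/\ definable H, H `<=` G, H e,
      (forall g h, H g -> H h -> H (mul g h)) & (forall g, H g -> H (inv g))].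

Definition normal_subgroup n (G H : set 'rV[R]_n) mul (inv : 'rV[R]_n -> 'rV[R]_n) :=
  forall g h, G g -> H h -> H (mul (mul g h) (inv g)).

Definition topgroup n (G : set 'rV[R]_n) (opn : set (set 'rV[R]_n)) mul inv :=
  (forall g h, G g -> G h -> forall V, opn V -> V (mul g h) ->
     exists A B, [/\ opn A, opn B, A g, B h &
                     forall a b, A a -> B b -> V (mul a b)]) /\
  (forall g, G g -> forall V, opn V -> V (inv g) ->
     exists A, [/\ opn A, A g & forall a, A a -> V (inv a)]).

(* sigma is the definable manifold topology of the definable group G:
   a topology making G a topological group and a definable manifold *)
Definition group_topology n (G : set 'rV[R]_n) mul inv (sigma : set (set 'rV[R]_n)) :=
  (exists d, def_manifold G sigma d) /\ topgroup G sigma mul inv.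

(* iota identifies G/H with the definable set iota @` G *)
Definition quot_map n k (G H : set 'rV[R]_n) mul (inv : 'rV[R]_n -> 'rV[R]_n)
    (iota : 'rV[R]_n -> 'rV[R]_k) :=
  definable_fun G iota /\
  forall g h, G g -> G h -> (iota g = iota h <-> H (mul (inv g) h)).

Definition quot_top n k (G : set 'rV[R]_n) (iota : 'rV[R]_n -> 'rV[R]_k)
    (sigma : set (set 'rV[R]_n)) : set (set 'rV[R]_k) :=
  [set U | U `<=` iota @` G /\ sigma [set g | G g /\ U (iota g)]].

Definition action_continuous n k (G : set 'rV[R]_n) mul (iota : 'rV[R]_n -> 'rV[R]_k)
    (sigma : set (set 'rV[R]_n)) (tau : set (set 'rV[R]_k)) :=
  forall g g', G g -> G g' -> forall V, tau V -> V (iota (mul g g')) ->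
    exists A B, [/\ sigma A, tau B, A g, B (iota g') &
      forall a b, A a -> G b -> B (iota b) -> V (iota (mul a b))].

Definition quot_topgroup n k (G : set 'rV[R]_n) mul (inv : 'rV[R]_n -> 'rV[R]_n)
    (iota : 'rV[R]_n -> 'rV[R]_k) (mu : set (set 'rV[R]_k)) :=
  (forall g h, G g -> G h -> forall V, mu V -> V (iota (mul g h)) ->
     exists A B, [/\ mu A, mu B, A (iota g), B (iota h) &
       forall a b, G a -> G b -> A (iota a) -> B (iota b) -> V (iota (mul a b))]) /\
  (forall g, G g -> forall V, mu V -> V (iota (inv g)) ->
     exists A, [/\ mu A, A (iota g) &
       forall a, G a -> A (iota a) -> V (iota (inv a))]).

End Defs.

(* Main.v *)
(** The easy inclusion is that [tau]-open sets are [quot_top]-open, by continuity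
    of the action at [(g, eH)].  For the converse it suffices, by homogeneity, to
    find one point [g0] of [G] all of whose neighbourhoods have an image in [G/H]
    with nonempty [tau]-interior.  Neither dimension theory nor definable choice
    is needed.  Call a subset of [R^n] fat if it has nonempty interior.  By
    induction on [n], o-minimality yields: a finite union of definable nonfat sets
    is nonfat, and so is the union of a definable chain of nonfat sets.  Now let
    [Z] be a definable relation between [R^n] and [R^m] whose first projection is
    fat.  If each [y] in the second projection had a neighbourhood with nonfat
    preimage, then by the chain property one radius [d] would do on a relation
    with still fat first projection; cutting [R^m] into boxes of radius [d / 2]
    coordinate by coordinate keeps the first projection fat, a contradiction.
    Through charts this holds for definable relations between manifolds.  Applied
    to the graph of the projection [G -> G/H], read in one direction, it gives
    [g0]; read in the other, it gives the continuity of [G -> G/H] for the group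
    manifold topology of [G/H], so that the first part applies to it. *)

Require Import Defs.
From mathcomp Require Import all_boot all_order all_algebra.
From mathcomp Require Import boolp classical_sets topology normedtype.
From mathcomp Require Import lra.
Set Implicit Arguments. Unset Strict Implicit. Unset Printing Implicit Defensive.
Import Order.TTheory GRing.Theory Num.Theory.
Import numFieldTopology.Exports.
Local Open Scope classical_set_scope.
Local Open Scope ring_scope.

(** * Definable predicates and functions *)

Section Definability.
Variables (R : rcfType) (S : ostructure R).

Definition dpred N (P : 'rV[R]_N -> Prop) := Sdef S P.

(** Total functions only. The maps of the statement are meaningful on a domain alone, and enter as
    relations through [def2_graph]. *)
Definition dfun N (t : 'rV[R]_N -> R) :=
  dpred (fun z : 'rV[R]_(N + 1) => t (lsubmx z) = rsubmx z ord0 ord0).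

Definition dmap N n (F : 'rV[R]_N -> 'rV[R]_n) :=
  forall i, dfun (fun w => F w ord0 i).

Lemma dpred_ext N (P Q : 'rV[R]_N -> Prop) :
  (forall w, P w <-> Q w) -> dpred P -> dpred Q.
Proof.
move=> PQ; suff -> : P = Q by [].
by apply/funext => w; apply/propext.
Qed.

Lemma dpred_not N (P : 'rV[R]_N -> Prop) : dpred P -> dpred (fun w => ~ P w).
Proof. exact: Sdef_setC. Qed.

Lemma dpred_or N (P Q : 'rV[R]_N -> Prop) :
  dpred P -> dpred Q -> dpred (fun w => P w \/ Q w).
Proof. exact: Sdef_setU. Qed.

Lemma dpred_and N (P Q : 'rV[R]_N -> Prop) :
  dpred P -> dpred Q -> dpred (fun w => P w /\ Q w).
Proof.
move=> dP dQ.
apply: (@dpred_ext _ (fun w => ~ (~ P w \/ ~ Q w))).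
  by move=> w; rewrite not_orE !notK.
by apply: dpred_not; apply: dpred_or; apply: dpred_not.
Qed.

Lemma dpred_imp N (P Q : 'rV[R]_N -> Prop) :
  dpred P -> dpred Q -> dpred (fun w => P w -> Q w).
Proof.
move=> dP dQ.
apply: (@dpred_ext _ (fun w => ~ P w \/ Q w)).
  by move=> w; rewrite implyE.
by apply: dpred_or => //; apply: dpred_not.
Qed.

Lemma dpred_const N (P : Prop) : dpred (fun _ : 'rV[R]_N => P).
Proof.
have [p|np] := pselect P.
  by apply: (dpred_ext _ (Sdef_setT _ S N)).
apply: (dpred_ext _ (Sdef_setC _ S _ _ (Sdef_setT _ S N))) => w.
by split => // /(_ I).
Qed.

Lemma dpred_allseq N (I : Type) (s : seq I) (P : 'rV[R]_N -> I -> Prop) :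
  (forall i, dpred (P^~ i)) ->
  dpred (fun w => foldr (fun i Q => P w i /\ Q) True s).
Proof.
by move=> dP; elim: s => [|i s IH] /=; [apply: dpred_const|apply: dpred_and].
Qed.

Lemma dpred_allfin N (I : finType) (P : 'rV[R]_N -> I -> Prop) :
  (forall i, dpred (P^~ i)) -> dpred (fun w => forall i, P w i).
Proof.
move=> dP; apply: (dpred_ext _ (dpred_allseq (enum I) dP)) => w; split.
  move=> H i; have : i \in enum I by rewrite mem_enum.
  elim: (enum I) H => [//|j s IH] /= [Pj Ps]; rewrite in_cons => /orP[/eqP->//|].
  exact: IH.
by move=> H; elim: (enum I) => [//|j s IH] /=.
Qed.

Lemma dpred_ex N m (Q : 'rV[R]_N -> 'rV[R]_m -> Prop) :
  dpred (fun z : 'rV[R]_(N + m) => Q (lsubmx z) (rsubmx z)) ->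
  dpred (fun w => exists y, Q w y).
Proof.
move=> /Sdef_proj dQ; apply: dpred_ext dQ => w.
by split=> -[y Qy]; exists y; move: Qy; rewrite /= row_mxKl row_mxKr.
Qed.

Lemma dpred_all N m (Q : 'rV[R]_N -> 'rV[R]_m -> Prop) :
  dpred (fun z : 'rV[R]_(N + m) => Q (lsubmx z) (rsubmx z)) ->
  dpred (fun w => forall y, Q w y).
Proof.
move=> dQ; apply: (@dpred_ext _ (fun w => ~ exists y, ~ Q w y)).
  by move=> w; rewrite -forallNE; split=> H y; [apply: contrapT; apply: H|apply].
by apply: dpred_not; apply: dpred_ex; apply: dpred_not.
Qed.

(** Coordinates may be permuted, repeated or dropped: the preimage is the projection of a cylinder
    over [A] cut by finitely many diagonals. *)
Lemma dpred_reindex n m (f : 'I_n -> 'I_m) (A : 'rV[R]_n -> Prop) :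
  dpred A -> dpred (fun w : 'rV[R]_m => A (\row_i w ord0 (f i))).
Proof.
move=> dA.
apply: (@dpred_ext _ (fun w => exists y : 'rV[R]_n,
    A y /\ forall i, y ord0 i = w ord0 (f i))).
  move=> w; split=> [[y [Ay yE]]|Aw].
    by suff -> : \row_i w ord0 (f i) = y by []; apply/rowP => i; rewrite mxE yE.
  by exists (\row_i w ord0 (f i)); split=> // i; rewrite mxE.
apply: dpred_ex; apply: dpred_and.
  apply: (dpred_ext _ (Sdef_prod _ S _ _ _ _ (Sdef_setT _ S m) dA)) => z /=.
  split=> [[a [b [_ Ab ->]]]|Az]; first by rewrite row_mxKr.
  by exists (lsubmx z), (rsubmx z); rewrite hsubmxK.
apply: dpred_allfin => i.
apply: (dpred_ext _ (Sdef_diag _ S _ (rshift m i) (lshift n (f i)))) => z /=.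
by rewrite !mxE.
Qed.

(** Composition in the case where [F] merely selects coordinates, so that reindexing the graph of
    [t] suffices. General substitution is bootstrapped from it. *)
Lemma dpred_graph N M (t : 'rV[R]_N -> R) (F : 'rV[R]_M -> 'rV[R]_N)
    (f : 'I_N -> 'I_M) (j : 'I_M) :
  (forall w i, F w ord0 i = w ord0 (f i)) ->
  dfun t -> dpred (fun w => t (F w) = w ord0 j).
Proof.
move=> FE dt.
pose g (i : 'I_(N + 1)) := match split i with inl a => f a | inr _ => j end.
apply: (dpred_ext _ (dpred_reindex g dt)) => w /=.
have -> : lsubmx (\row_i w ord0 (g i)) = F w.
  apply/rowP => i; rewrite !mxE FE /g.
  by rewrite -[lshift _ _]/(unsplit (inl i)) unsplitK.
rewrite !mxE /g -[rshift _ _]/(unsplit (inr ord0)) unsplitK.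
by [].
Qed.

(** The value [F w] is quantified existentially and pinned down coordinate by coordinate through the
    graphs of the components. *)
Lemma dpred_comp N n (A : 'rV[R]_n -> Prop) (F : 'rV[R]_N -> 'rV[R]_n) :
  dpred A -> dmap F -> dpred (fun w => A (F w)).
Proof.
move=> dA dF.
apply: (@dpred_ext _ (fun w => exists y : 'rV[R]_n,
    A y /\ forall i, F w ord0 i = y ord0 i)).
  move=> w; split=> [[y [Ay yE]]|Aw]; last by exists (F w).
  by suff -> : F w = y by []; apply/rowP.
apply: dpred_ex; apply: dpred_and.
  apply: (dpred_ext _ (dpred_reindex (@rshift N n) dA)) => w.
  suff -> : \row_i w ord0 (rshift N i) = rsubmx w by [].
  by apply/rowP => i; rewrite !mxE.
apply: dpred_allfin => i.
apply: (dpred_ext _ (@dpred_graph _ _ _ (fun z : 'rV[R]_(N + n) => lsubmx z)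
  (@lshift N n) (rshift N i) _ (dF i))) => z /=.
  by rewrite !mxE.
by move=> ?; rewrite mxE.
Qed.

Lemma dfun_coord N (i : 'I_N) : dfun (fun w => w ord0 i).
Proof.
apply: (dpred_ext _ (Sdef_diag _ S _ (lshift 1 i) (rshift N ord0))) => z /=.
by rewrite !mxE.
Qed.

Lemma dfun_dmap N n (F : 'rV[R]_N -> 'rV[R]_n) i :
  dmap F -> dfun (fun w => F w ord0 i).
Proof. exact. Qed.

Lemma dmap_id N : dmap (fun w : 'rV[R]_N => w).
Proof. by move=> i; apply: dfun_coord. Qed.

Lemma dfun_ext N (t s : 'rV[R]_N -> R) : t =1 s -> dfun t -> dfun s.
Proof. by move=> /funext ->. Qed.

Lemma dmap_lsub N n m (F : 'rV[R]_N -> 'rV[R]_(n + m)) :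
  dmap F -> dmap (fun w => lsubmx (F w)).
Proof. by move=> dF i; apply: dfun_ext (dF (lshift m i)) => w; rewrite mxE. Qed.

Lemma dmap_rsub N n m (F : 'rV[R]_N -> 'rV[R]_(n + m)) :
  dmap F -> dmap (fun w => rsubmx (F w)).
Proof. by move=> dF i; apply: dfun_ext (dF (rshift n i)) => w; rewrite mxE. Qed.

Lemma dmap_row N n m (F : 'rV[R]_N -> 'rV[R]_n) (G : 'rV[R]_N -> 'rV[R]_m) :
  dmap F -> dmap G -> dmap (fun w => row_mx (F w) (G w)).
Proof.
move=> dF dG i; rewrite -[i]splitK; case: (split i) => j /=.
  by apply: dfun_ext (dF j) => w; rewrite row_mxEl.
by apply: dfun_ext (dG j) => w; rewrite row_mxEr.
Qed.

Lemma dmap_const_mx N n (t : 'rV[R]_N -> R) :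
  dfun t -> dmap (fun w => const_mx (t w) : 'rV[R]_n).
Proof. by move=> dt i; apply: dfun_ext dt => w; rewrite mxE. Qed.

Lemma dmap_pair N (t s : 'rV[R]_N -> R) : dfun t -> dfun s ->
  dmap (fun w => \row_(i < 2) if i == ord0 then t w else s w).
Proof.
move=> dt ds i; have [i0|i0] := boolP (i == ord0).
  by apply: dfun_ext dt => w; rewrite mxE i0.
by apply: dfun_ext ds => w; rewrite mxE (negbTE i0).
Qed.

Lemma dpred_rel N n m (Q : 'rV[R]_n -> 'rV[R]_m -> Prop)
    (F : 'rV[R]_N -> 'rV[R]_n) (G : 'rV[R]_N -> 'rV[R]_m) :
  dpred (fun z : 'rV[R]_(n + m) => Q (lsubmx z) (rsubmx z)) ->
  dmap F -> dmap G -> dpred (fun w => Q (F w) (G w)).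
Proof.
move=> dQ dF dG; apply: (dpred_ext _ (dpred_comp dQ (dmap_row dF dG))) => w.
by rewrite row_mxKl row_mxKr.
Qed.

Lemma dpred_lt N (t s : 'rV[R]_N -> R) :
  dfun t -> dfun s -> dpred (fun w => t w < s w).
Proof.
move=> dt ds; apply: (dpred_ext _ (dpred_comp (Sdef_lt _ S) (dmap_pair dt ds))).
by move=> w; rewrite /= !mxE -!val_eqE /= !inordK.
Qed.

Lemma dpred_le N (t s : 'rV[R]_N -> R) :
  dfun t -> dfun s -> dpred (fun w => t w <= s w).
Proof.
move=> dt ds; apply: (dpred_ext _ (dpred_not (dpred_lt ds dt))) => w.
by rewrite leNgt; split=> /negP.
Qed.

Lemma dpred_eq N (t s : 'rV[R]_N -> R) :
  dfun t -> dfun s -> dpred (fun w => t w = s w).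
Proof.
move=> dt ds; apply: (dpred_ext _ (dpred_and (dpred_le dt ds) (dpred_le ds dt))).
by move=> w; split=> [[? ?]|->]; [apply/le_anti/andP|].
Qed.

Lemma dfun_comp N M (t : 'rV[R]_N -> R) (F : 'rV[R]_M -> 'rV[R]_N) :
  dfun t -> dmap F -> dfun (fun w => t (F w)).
Proof.
move=> dt dF.
apply: (@dpred_rel _ _ _ (fun u (v : 'rV[R]_1) => t u = v ord0 ord0)
  (fun z : 'rV_(M + 1) => F (lsubmx z)) (fun z => rsubmx z) dt).
  move=> i; apply: (dpred_ext _ (@dpred_graph _ _ _
   (fun z : 'rV[R]_(M + 1 + 1) => lsubmx (lsubmx z))
   (fun i => lshift 1 (lshift 1 i)) (rshift _ ord0) _ (dF i))) => z /=.
    by rewrite !mxE.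
  by move=> ?; rewrite !mxE.
exact/dmap_rsub/dmap_id.
Qed.

Lemma dfun_const N (a : R) : dfun (fun _ : 'rV[R]_N => a).
Proof.
apply: (dpred_ext _ (dpred_reindex (fun=> rshift N ord0) (Sdef_pt _ S a))) => w.
by rewrite /= !mxE; split.
Qed.

Lemma dmap_const N n (a : 'rV[R]_n) : dmap (fun _ : 'rV[R]_N => a).
Proof. by move=> i; apply: dfun_const. Qed.

Lemma dfun_binop (op : R -> R -> R) :
  Sdef S [set x : 'rV[R]_3 |
    op (x ord0 (inord 0)) (x ord0 (inord 1)) = x ord0 (inord 2)] ->
  forall N (t s : 'rV[R]_N -> R),
    dfun t -> dfun s -> dfun (fun w => op (t w) (s w)).
Proof.
move=> dop N t s dt ds.
have dop2 : dfun (fun u : 'rV[R]_2 => op (u ord0 ord0) (u ord0 ord_max)).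
  have e0 : inord 0 = @lshift 2 1 ord0 :> 'I_3 by apply/val_inj; rewrite /= inordK.
  have e1 : inord 1 = @lshift 2 1 ord_max :> 'I_3 by apply/val_inj; rewrite /= inordK.
  have e2 : inord 2 = @rshift 2 1 ord0 :> 'I_3 by apply/val_inj; rewrite /= inordK.
  by apply: (dpred_ext _ dop) => z; rewrite /= !mxE e0 e1 e2.
apply: dfun_ext (dfun_comp dop2 (dmap_pair dt ds)) => w.
by rewrite !mxE.
Qed.

Lemma dfun_add N (t s : 'rV[R]_N -> R) :
  dfun t -> dfun s -> dfun (fun w => t w + s w).
Proof. exact: dfun_binop (Sdef_add _ S) _ _ _. Qed.

Lemma dfun_mul N (t s : 'rV[R]_N -> R) :
  dfun t -> dfun s -> dfun (fun w => t w * s w).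
Proof. exact: dfun_binop (Sdef_mul _ S) _ _ _. Qed.

Lemma dfun_opp N (t : 'rV[R]_N -> R) : dfun t -> dfun (fun w => - t w).
Proof.
move=> dt; apply: dfun_ext (dfun_mul (dfun_const _ (-1)) dt) => w.
by rewrite mulN1r.
Qed.

Lemma dpred_exR N (Q : 'rV[R]_N -> R -> Prop) :
  dpred (fun z : 'rV[R]_(N + 1) => Q (lsubmx z) (rsubmx z ord0 ord0)) ->
  dpred (fun w => exists t, Q w t).
Proof.
move=> dQ; have := @dpred_ex N 1 (fun w y => Q w (y ord0 ord0)) dQ.
apply: dpred_ext => w; split=> -[y Qy]; first by exists (y ord0 ord0).
by exists (const_mx y); rewrite mxE.
Qed.

Lemma dpred_allR N (Q : 'rV[R]_N -> R -> Prop) :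
  dpred (fun z : 'rV[R]_(N + 1) => Q (lsubmx z) (rsubmx z ord0 ord0)) ->
  dpred (fun w => forall t, Q w t).
Proof.
move=> dQ; have := @dpred_all N 1 (fun w y => Q w (y ord0 ord0)) dQ.
apply: dpred_ext => w; split=> Qw y; last exact: Qw.
by have := Qw (const_mx y); rewrite mxE.
Qed.

Lemma dpred_relR N n (Q : R -> 'rV[R]_n -> Prop)
    (t : 'rV[R]_N -> R) (F : 'rV[R]_N -> 'rV[R]_n) :
  dpred (fun z : 'rV[R]_(1 + n) => Q (lsubmx z ord0 ord0) (rsubmx z)) ->
  dfun t -> dmap F -> dpred (fun w => Q (t w) (F w)).
Proof.
move=> dQ dt dF.
apply: (dpred_ext _ (@dpred_rel _ _ _ (fun u : 'rV_1 => Q (u ord0 ord0)) _ _ dQ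
  (@dmap_const_mx _ 1 _ dt) dF)) => w.
by rewrite mxE.
Qed.

Lemma dpred_setR N (A : R -> Prop) (t : 'rV[R]_N -> R) :
  dpred (fun z : 'rV[R]_1 => A (z ord0 ord0)) ->
  dfun t -> dpred (fun w => A (t w)).
Proof.
move=> dA dt; apply: (dpred_ext _ (dpred_comp dA (@dmap_const_mx _ 1 _ dt))) => w.
by rewrite mxE.
Qed.

End Definability.

(** * Definable subsets of the line *)

Section Line.
Variables (R : rcfType) (S : ostructure R).

Definition def1 (A : R -> Prop) := dpred S (fun z : 'rV[R]_1 => A (z ord0 ord0)).

Definition fat1 (A : R -> Prop) :=
  exists a b : R, a < b /\ forall y : R, a < y -> y < b -> A y.

Lemma def1_itv (A : R -> Prop) : def1 A ->
  exists s : seq (interval R), forall y, A y <-> has (fun I => y \in I) s.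
Proof.
move=> /(Sdef_omin _ S)[s /seteqP[As sA]]; exists s => y.
have /= := As (const_mx y); have /= := sA (const_mx y); rewrite !mxE.
by split.
Qed.

(** Membership in [A] is eventually constant as [y] decreases to [c]. This and the existence of
    suprema are the two forms in which o-minimality is used. *)
Definition right_germ (c : R) (A : R -> Prop) :=
  exists b : R, c < b /\ ((forall y : R, c < y -> y < b -> A y) \/
                          (forall y : R, c < y -> y < b -> ~ A y)).

Lemma right_germ_not c (A : R -> Prop) :
  right_germ c A -> right_germ c (fun y => ~ A y).
Proof.
move=> [b [cb [H|H]]]; exists b; split=> //; [right|left] => y cy yb.
  by move/(_ (H y cy yb)).
exact: H.
Qed.

Lemma right_germ_and c (A B : R -> Prop) :
  right_germ c A -> right_germ c B -> right_germ c (fun y => A y /\ B y).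
Proof.
move=> [b [cb HA]] [b' [cb' HB]]; exists (Num.min b b').
split; first by rewrite lt_min cb.
have [HA1|HA1] := HA.
  have [HB1|HB1] := HB.
    by left=> y cy; rewrite lt_min => /andP[? ?]; split; [apply: HA1|apply: HB1].
  by right=> y cy; rewrite lt_min => /andP[? ?] [_]; apply: HB1.
by right=> y cy; rewrite lt_min => /andP[? ?] [+ _]; apply: HA1.
Qed.

Lemma right_germ_ext c (A B : R -> Prop) :
  (forall y, A y <-> B y) -> right_germ c A -> right_germ c B.
Proof. by move=> AB; suff -> : A = B by []; apply/funext => y; apply/propext. Qed.

Lemma right_germ_gt c a : right_germ c (fun y => a < y).
Proof.
have [ac|ca] := leP a c.
  by exists (c + 1); split; [lra|left=> y cy _; lra].
by exists a; split=> //; right=> y cy ya; lra.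
Qed.

Lemma right_germ_ge c a : right_germ c (fun y => a <= y).
Proof.
have [ac|ca] := leP a c.
  by exists (c + 1); split; [lra|left=> y cy _; lra].
by exists a; split=> //; right=> y cy ya; lra.
Qed.

Lemma right_germ_const c (P : Prop) : right_germ c (fun=> P).
Proof.
by exists (c + 1); split; [lra|have [p|p] := pselect P; [left|right]].
Qed.

Lemma right_germ_itv c (I : interval R) : right_germ c (fun y => y \in I).
Proof.
case: I => l u.
apply: (@right_germ_ext _ (fun y => (l <= BLeft y)%O /\ (BRight y <= u)%O)).
  by move=> y; rewrite itv_boundlr; split=> [[-> ->]|/andP[]].
apply: right_germ_and.
  case: l => [[] a|[]].
  - by apply: right_germ_ext (right_germ_ge c a) => y; rewrite bnd_simp.
  - by apply: right_germ_ext (right_germ_gt c a) => y; rewrite bnd_simp.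
  - by apply: right_germ_ext (right_germ_const c True) => y; rewrite bnd_simp.
  - by apply: right_germ_ext (right_germ_const c False) => y; rewrite bnd_simp.
case: u => [[] a|[]].
- apply: right_germ_ext (right_germ_not (right_germ_ge c a)) => y.
  by rewrite bnd_simp; split=> [/negP|? ]; [rewrite -ltNge|lra].
- apply: right_germ_ext (right_germ_not (right_germ_gt c a)) => y.
  by rewrite bnd_simp; split=> [/negP|? ]; [rewrite -leNgt|lra].
- by apply: right_germ_ext (right_germ_const c False) => y; rewrite bnd_simp.
- by apply: right_germ_ext (right_germ_const c True) => y; rewrite bnd_simp.
Qed.

(** Intervals have right germs, and a finite union is reached by de Morgan from negations and
    conjunctions. *)
Lemma def1_right_germ (A : R -> Prop) c : def1 A -> right_germ c A.
Proof.
move=> /def1_itv[s As]; apply: (right_germ_ext (fun y => iff_sym (As y))).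
elim: s {As} => [|I s IH] /=; first exact: right_germ_const.
apply: (@right_germ_ext _ (fun y => ~ (~ (y \in I) /\ ~ has (fun J => y \in J) s))).
  move=> y; case: (y \in I) => /=; first by split=> // _ [].
  by split=> [|hs [_]]; [move=> H; apply: contrapT => K; apply: H|].
by apply/right_germ_not/right_germ_and; apply: right_germ_not => //; apply: right_germ_itv.
Qed.

Definition is_lub (A : R -> Prop) l :=
  (forall y, A y -> y <= l) /\ (forall y : R, y < l -> exists z, A z /\ y < z).

Lemma itv_lub (I : interval R) M : (exists y, y \in I) ->
  (forall y, y \in I -> y <= M) -> exists l, is_lub (fun y => y \in I) l.
Proof.
case: I => l u [y]; rewrite itv_boundlr => /andP[ly yu] uM.
case: u yu uM => [[] a|[]] yu uM; last 2 first.
- by [].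
(* An interval unbounded above would contain [M + 1]. *)
- have : y <= M by apply: uM; rewrite itv_boundlr ly yu.
  move=> yM; suff : M + 1 <= M by lra.
  apply: uM; rewrite itv_boundlr bnd_simp andbT; apply: le_trans ly _.
  by rewrite bnd_simp; lra.
- move: yu; rewrite bnd_simp => ya; exists a; split=> [z|z za].
    by rewrite itv_boundlr => /andP[_]; rewrite bnd_simp => /ltW.
  have [zy|yz] := ltP z y.
    by exists y; split=> //; rewrite itv_boundlr ly bnd_simp.
  exists ((z + a) / 2); split; last by lra.
  rewrite itv_boundlr; apply/andP; split; last by rewrite bnd_simp; lra.
  by apply: le_trans ly _; rewrite bnd_simp; lra.
- move: yu; rewrite bnd_simp => ya; exists a; split=> [z|z za].
    by rewrite itv_boundlr => /andP[_]; rewrite bnd_simp.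
  exists a; split=> //; rewrite itv_boundlr bnd_simp lexx andbT.
  by apply: le_trans ly _; rewrite bnd_simp.
Qed.

Lemma is_lub_or (A B : R -> Prop) a b : is_lub A a -> is_lub B b ->
  is_lub (fun y => A y \/ B y) (Num.max a b).
Proof.
move=> [Aa a'] [Bb b']; split=> [y [/Aa|/Bb]|y].
- by rewrite le_max => ->.
- by rewrite le_max => ->; rewrite orbT.
by rewrite lt_max => /orP[/a'|/b'] [z [? ?]]; exists z; split=> //; [left|right].
Qed.

(** A real closed field need not be complete, but a definable set is a finite union of intervals,
    and its supremum is the largest of their upper ends. *)
Lemma def1_lub (A : R -> Prop) M : def1 A -> (exists y, A y) ->
  (forall y, A y -> y <= M) -> exists l, is_lub A l.
Proof.
move=> /def1_itv[s As].
have -> : A = (fun y => has (fun I => y \in I) s).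
  by apply/funext => y; apply/propext.
elim: s {As} => [[]//|I s IH] /= nes ubM.
have orE : (fun y => (y \in I) || has (fun J => y \in J) s : Prop) =
   (fun y => y \in I \/ has (fun J => y \in J) s).
  by apply/funext => y; apply/propext; split=> /orP.
(* An empty interval has no supremum in the sense of [is_lub], so it is discarded rather than
   entered in the maximum. *)
have [neI|eI] := pselect (exists y, y \in I); last first.
  have -> : (fun y => (y \in I) || has (fun J => y \in J) s : Prop) =
     (fun y => has (fun J => y \in J) s).
    apply/funext => y; apply/propext.
    by split=> [/orP[yI|//]|->]; [case: eI; exists y|rewrite orbT].
  apply: IH => [|y ys]; last by apply: ubM; rewrite ys orbT.
  by case: nes => y /orP[yI|ys]; [case: eI; exists y|exists y].
have [a lubI] : exists a, is_lub (fun y => y \in I) a.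
  by apply: (@itv_lub _ M) => // y yI; apply: ubM; rewrite yI.
have [es|es] := pselect (exists y, has (fun J => y \in J) s).
  have [b lubs] := IH es (fun y ys => ubM y (introT orP (or_intror ys))).
  by exists (Num.max a b); rewrite orE; apply: is_lub_or.
exists a; suff -> : (fun y => (y \in I) || has (fun J => y \in J) s : Prop) =
     (fun y => y \in I) by [].
apply/funext => y; apply/propext.
by split=> [/orP[//|ys]|->//]; case: es; exists y.
Qed.

(** Just to the right of [a] either [A] holds throughout, or it fails throughout and [B] must hold
    there. *)
Lemma fat1_or (A B : R -> Prop) : def1 A ->
  fat1 (fun y => A y \/ B y) -> fat1 A \/ fat1 B.
Proof.
move=> dA [a [b [ab AB]]]; have [c [ac cP]] := def1_right_germ a dA.
have am : a < Num.min b c by rewrite lt_min ab.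
case: cP => cA; [left|right]; exists a, (Num.min b c); split=> // y ay;
  rewrite lt_min => /andP[yb yc]; first exact: cA.
by case: (AB y ay yb) => // Ay; have := cA y ay yc.
Qed.

End Line.

(** * Boxes, fat sets and automatic definability *)

Definition box (R : rcfType) n (c : 'rV[R]_n) (r : R) (x : 'rV[R]_n) :=
  forall i, c ord0 i - r < x ord0 i /\ x ord0 i < c ord0 i + r.

Definition fat (R : rcfType) n (A : 'rV[R]_n -> Prop) :=
  exists (c : 'rV[R]_n) (r : R), 0 < r /\ forall x, box c r x -> A x.

(** [def2], [defR] and [defRR] give definable relations a head symbol by which [definable_step]
    recognises them; each [R] marks a scalar argument. *)
Definition def2 (R : rcfType) (S : ostructure R) n m
    (Q : 'rV[R]_n -> 'rV[R]_m -> Prop) :=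
  dpred S (fun z : 'rV[R]_(n + m) => Q (lsubmx z) (rsubmx z)).

Definition defR (R : rcfType) (S : ostructure R) n (Q : R -> 'rV[R]_n -> Prop) :=
  dpred S (fun z : 'rV[R]_(1 + n) => Q (lsubmx z ord0 ord0) (rsubmx z)).

Definition defRR (R : rcfType) (S : ostructure R) (Q : R -> R -> Prop) :=
  dpred S (fun z : 'rV[R]_(1 + 1) => Q (lsubmx z ord0 ord0) (rsubmx z ord0 ord0)).

Lemma dpred_relRR (R : rcfType) (S : ostructure R) N (Q : R -> R -> Prop)
    (t s : 'rV[R]_N -> R) :
  defRR S Q -> dfun S t -> dfun S s -> dpred S (fun w => Q (t w) (s w)).
Proof.
move=> dQ dt ds.
apply: (dpred_ext _ (@dpred_relR _ S _ 1 (fun u v => Q u (v ord0 ord0)) t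
  (fun w => const_mx (s w)) dQ dt (@dmap_const_mx _ S _ 1 _ ds))) => w.
by rewrite mxE.
Qed.

Ltac definable_step :=
  lazymatch goal with
  | |- def1 _ _ => rewrite /def1
  | |- def2 _ _ => rewrite /def2
  | |- defR _ _ => rewrite /defR
  | |- defRR _ _ => rewrite /defRR
  | |- dmap _ _ => first
      [ apply: dmap_id | apply: dmap_const | apply: dmap_lsub | apply: dmap_rsub
      | apply: dmap_row | apply: (@dmap_row _ _ _ 1) | apply: dmap_const_mx ]
  | |- dfun _ _ => first
      [ apply: dfun_const | apply: dfun_add | apply: dfun_opp | apply: dfun_mul
      | apply: dfun_dmap ]
  | |- dpred _ _ => first
      [ assumption
      | apply: dpred_const
      | apply: dpred_and | apply: dpred_or | apply: dpred_not | apply: dpred_imp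
      | apply: dpred_allR | apply: dpred_exR | apply: dpred_ex | apply: dpred_all
      | apply: dpred_allfin => ?
      | apply: dpred_lt | apply: dpred_le | apply: dpred_eq
      | match goal with
        | H : defR _ _ |- _ => apply: (dpred_relR H)
        | H : defRR _ _ |- _ => apply: (dpred_relRR H)
        | H : def2 _ _ |- _ => apply: (dpred_rel H)
        | H : def1 _ _ |- _ => apply: (dpred_setR H)
        | H : dpred _ _ |- _ => apply: (dpred_comp H)
        end ]
  end.

(** Once unfolded, fatness is a first-order condition, so the parameters over which a fibre is fat
    form a definable set. *)
Ltac definable := rewrite /fat /fat1 /box; repeat definable_step.


(** * Sets with nonempty interior *)

Section Fat.
Variables (R : rcfType) (S : ostructure R).

Lemma fat1_chain (X : R -> R -> Prop) : defRR S X ->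
  (forall s t, (forall y, X s y -> X t y) \/ (forall y, X t y -> X s y)) ->
  fat1 (fun y => exists t, X t y) -> exists t, fat1 (X t).
Proof.
move=> dX chX [a [b [ab abX]]]; apply: contrapT => nX.
have dXt t : def1 S (X t) by definable.
(* [B] accumulates at [a], so it contains an interval [(a, b')]; there, the
   member of the chain first reaching [c] contains every [y > c]. *)
pose B y := exists t, X t y /\ forall z : R, a < z -> z < y -> ~ X t z.
have dB : def1 S B by rewrite /B; definable.
have coB c : a < c -> c < b -> exists2 y, a < y <= c & B y.
  move=> ac cb; have [t Xc] := abX c ac cb.
  (* As [X t] is not fat, it misses an interval just to the right of every point. *)
  have germX s : exists2 r, s < r & forall y, s < y -> y < r -> ~ X t y.
    have [r [sr [rX|rX]]] := def1_right_germ s (dXt t); last by exists r.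
    by case: nX; exists t, s, r.
  (* The supremum of [T] is the first point of [X t] beyond [a]: if it were outside [X t], the germ
     there would extend [T]. *)
  pose T (s : R) := a < s /\ forall z : R, a < z -> z < s -> ~ X t z.
  have dT : def1 S T by rewrite /T; definable.
  have [r ar rX] := germX a.
  have [l [Tl lT]] : exists l, is_lub T l.
    apply: (@def1_lub _ S T c) => //; first by exists r.
    by move=> s [as_ sX]; rewrite leNgt; apply/negP => cs; exact: (sX c).
  have al : a < l by apply: (lt_le_trans ar); apply: Tl.
  have lX z : a < z -> z < l -> ~ X t z.
    by move=> az /lT[s [[_ sX] zs]]; apply: sX.
  exists l.
    rewrite al /= leNgt; apply/negP => cl; exact: (lX c).
  exists t; split=> //; apply: contrapT => nXl.
  have [r' lr' rX'] := germX l.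
  suff : r' <= l by lra.
  apply: Tl; split; first lra.
  move=> z az zr'; have [zl|lz|->//] := ltgtP z l; first exact: lX.
  exact: rX'.
have [b' [ab' [B'|B']]] := def1_right_germ a dB; last first.
  have [||y /andP[ay yc]] := coB (Num.min ((a + b) / 2) ((a + b') / 2)).
  - by rewrite lt_min; apply/andP; split; lra.
  - by rewrite gt_min; apply/orP; left; lra.
  by apply: B' => //; move: yc; rewrite le_min => /andP[_]; lra.
pose c := (a + b') / 2.
have [|//|t [Xc cX]] := B' c; rewrite /c; [lra|lra|].
apply: nX; exists t, c, b'; split=> [|y cy yb']; first by rewrite /c; lra.
have [|//|s [Xy yX]] := B' y; first by move: cy; rewrite /c; lra.
(* [X s] has no point between [a] and [y], so it omits [c], which [X t] contains; comparability
   forces [X s] into [X t]. *)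
case: (chX t s) => [H|]; last exact.
have : ~ X s c by apply: yX => //; rewrite /c; lra.
by case; apply: H.
Qed.

(** Both stability properties are predicates of the dimension because each one in dimension [n.+1]
    relies on both in dimension [n]. *)
Definition fat_or_stable n := forall A B : 'rV[R]_n -> Prop,
  dpred S A -> dpred S B -> fat (fun x => A x \/ B x) -> fat A \/ fat B.

Definition chain n (X : R -> 'rV[R]_n -> Prop) :=
  forall s t, (forall x, X s x -> X t x) \/ (forall x, X t x -> X s x).

Definition fat_chain_stable n := forall X : R -> 'rV[R]_n -> Prop,
  defR S X -> chain X -> fat (fun y => exists t, X t y) -> exists t, fat (X t).

Lemma fat_sub n (A B : 'rV[R]_n -> Prop) :
  (forall x, A x -> B x) -> fat A -> fat B.
Proof.
by move=> AB [c [r [r0 cA]]]; exists c, r; split=> // x /cA; apply: AB.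
Qed.

(** The chain property bounds [y] by some [t]. At the supremum [l] of the cut-offs that leave a
    nonfat set, the window around [l] must be fat: otherwise a cut-off just below [l] could be
    raised to [l + d / 2] by [fat_or_stable]. *)
Lemma fat_localize1 n (Z : R -> 'rV[R]_n -> Prop) d :
  fat_or_stable n -> fat_chain_stable n -> defR S Z -> 0 < d ->
  fat (fun x => exists y, Z y x) ->
  exists y0, fat (fun x => exists y : R, [/\ y0 - d < y, y < y0 + d & Z y x]).
Proof.
move=> orS chS dZ d0 fZ; apply: contrapT => nZ.
have {}nZ y0 : ~ fat (fun x => exists y : R, y0 - d < y /\ y < y0 + d /\ Z y x).
  move=> H; apply: nZ; exists y0; apply: fat_sub H => x [y [? [? ?]]].
  by exists y; split.
pose X (t : R) x := exists y : R, (- t <= y) /\ (y <= t) /\ Z y x.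
have dX : defR S X by rewrite /X; definable.
have [t fX] : exists t, fat (X t).
  apply: chS => //.
    move=> s t; have [st|ts] := leP s t; [left|right] => x [y [sy [ys Zy]]];
    by exists y; split; [lra|split=> //; lra].
  apply: fat_sub fZ => x [y Zy]; exists `|y|, y; split=> //.
    by have := lexx `|y|; rewrite ler_norml => /andP[].
  by split=> //; apply: ler_norm.
pose T (s : R) := ~ fat (fun x => exists y : R, (- t <= y) /\ (y <= s) /\ Z y x).
have dT : def1 S T by rewrite /T; definable.
have [l [Tl lT]] : exists l, is_lub T l.
  apply: (@def1_lub _ S T t) => //.
    (* Below [- t] no [y] is left, so the set cut off is empty and nonfat. *)
    exists (- t - 1) => -[c [r [r0 cr]]].
    by have [|y [? [? _]]] := cr c; [move=> i; split; lra|lra].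
  move=> s Ts; rewrite leNgt; apply/negP => ts; apply: Ts; apply: fat_sub fX.
  by move=> x [y [? [? ?]]]; exists y; split=> //; split=> //; lra.
have [|z [Tz lz]] := lT (l - d / 2); first lra.
suff : l + d / 2 <= l by lra.
apply: Tl => fl.
have [] := @orS (fun x => exists y : R, (- t <= y) /\ (y <= z) /\ Z y x)
  (fun x => exists y : R, l - d < y /\ y < l + d /\ Z y x) => //.
- by definable.
- by definable.
- apply: fat_sub fl => x [y [ty [yl Zy]]].
  by have [yz|zy] := leP y z; [left|right]; exists y; do 2?split=> //; lra.
- exact: nZ.
Qed.

(** The first coordinate is split off, because [1 + n] converts to [n.+1] and no cast is
    required. *)
Definition slice n (A : 'rV[R]_n.+1 -> Prop) (x : 'rV[R]_n) (y : R) :=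
  A (row_mx (const_mx y : 'rV_1) x).

Lemma fat_slice n (A : 'rV[R]_n.+1 -> Prop) : fat A -> fat (fun x => fat1 (slice A x)).
Proof.
move=> [c [r [r0 cA]]].
exists (rsubmx (c : 'rV_(1 + n))), r; split=> // x xc.
pose c0 := lsubmx (c : 'rV_(1 + n)) ord0 ord0.
exists (c0 - r), (c0 + r); split=> [|y y1 y2]; first lra.
apply: cA => i; rewrite -[i](@splitK 1 n).
case: (split (i : 'I_(1 + n))) => j /=.
  by rewrite (@row_mxEl _ 1 1 n) mxE (ord1 j); move: y1 y2; rewrite /c0 mxE.
by rewrite (@row_mxEr _ 1 1 n); have := xc j; rewrite mxE.
Qed.

(** A topological Fubini principle. A common half-length [e] of the fibre intervals comes from the
    chain property, then their centres are confined to within [e / 2] of one [y0]; every fibre then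
    contains all points within [e / 2] of [y0]. *)
Lemma fat_of_slice n (A : 'rV[R]_n.+1 -> Prop) :
  fat_or_stable n -> fat_chain_stable n -> dpred S A ->
  fat (fun x => fat1 (slice A x)) -> fat A.
Proof.
move=> orS chS dA fA.
pose Z (e y : R) x := 0 < e /\ forall z : R, y - e < z -> z < y + e -> slice A x z.
have dsl : defR S (fun y x => slice A x y).
  by rewrite /slice; definable.
have [e] : exists e, fat (fun x => exists y, Z e y x).
  apply: (chS).
  - rewrite /Z; definable.
  (* Larger radii give smaller sets, and the clause [0 < e] makes the set empty for a nonpositive
     radius. *)
  - move=> s t; have [st|ts] := leP s t; last first.
      have [t0|t0] := ltP 0 t; [left|right] => x [y [e0 H]].
        by exists y; split=> // z ? ?; apply: H; lra.
      lra.
    have [s0|s0] := ltP 0 s; [right|left] => x [y [e0 H]].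
      by exists y; split=> // z ? ?; apply: H; lra.
    lra.
  apply: fat_sub fA => x [a [b [ab abA]]].
  exists ((b - a) / 2), ((a + b) / 2); split; first lra.
  by move=> z ? ?; apply: abA; lra.
have [e0|e0] := ltP 0 e; last first.
  by move=> [c [r [r0 cr]]]; have [|y []] := cr c; [move=> i; split; lra|lra].
move=> fe; have [||y0 [c [r [r0 cr]]]] := @fat_localize1 n (Z e) (e / 2) orS chS _ _ fe.
- rewrite /Z; definable.
- lra.
pose q := Num.min r (e / 2).
have q0 : 0 < q by rewrite lt_min r0 /=; lra.
have qr : q <= r by rewrite ge_min lexx.
have qe : q <= e / 2 by rewrite ge_min lexx orbT.
exists (row_mx (const_mx y0 : 'rV_1) c), q; split=> // x xq.
have [|y [y1 y2 [_ yA]]] := cr (rsubmx (x : 'rV_(1 + n))).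
  move=> i; have := xq (rshift 1 i); rewrite (@row_mxEr _ 1 1 n) mxE => -[? ?]; split; lra.
have := xq (lshift n (ord0 : 'I_1)); rewrite (@row_mxEl _ 1 1 n) !mxE => -[x1 x2].
have := yA (x ord0 (lshift n (ord0 : 'I_1))); rewrite /slice.
suff -> : row_mx (const_mx (x ord0 (lshift n (ord0 : 'I_1))) : 'rV_1) (rsubmx (x : 'rV_(1 + n))) = x.
  by apply; lra.
rewrite -[RHS](@hsubmxK _ 1 1 n); congr row_mx.
by apply/rowP => i; rewrite !mxE (ord1 i).
Qed.

(** In dimension 0, fat means containing the only point. In the step, [fat_slice] and [fat_of_slice]
    trade fatness of a set for fatness of the base over which its fibres are fat, and the fibres
    obey [fat1_or] and [fat1_chain]. *)
Lemma fat_stable n : fat_or_stable n /\ fat_chain_stable n.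
Proof.
elim: n => [|n [orS chS]].
  have f0 (A : 'rV[R]_0 -> Prop) : fat A <-> A 0.
    split=> [[c [r [r0]]]|A0]; first by apply=> -[].
    by exists 0, 1; split=> // x _; rewrite thinmx0.
  split=> [A B _ _|X _ _]; first by rewrite !f0.
  by rewrite f0 => -[t Xt]; exists t; rewrite f0.
split=> [A B dA dB fAB|X dX chX fX].
  have dsA : defR S (fun y x => slice A x y).
    by rewrite /slice; definable.
  have dsB : defR S (fun y x => slice B x y).
    by rewrite /slice; definable.
  have [] := @orS (fun x => fat1 (slice A x)) (fun x => fat1 (slice B x)).
  - definable.
  - definable.
  - apply: fat_sub (fat_slice fAB) => x; apply: (@fat1_or _ S).
    by apply: (dpred_relR (t := fun w => w ord0 ord0) (F := fun=> x) dsA); definable.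
  - by left; apply: fat_of_slice.
  - by right; apply: fat_of_slice.
have dXt t : dpred S (X t).
  by apply: (dpred_relR (t := fun=> t) (F := fun w => w) dX); definable.
have [t ft] : exists t, fat (fun x => fat1 (slice (X t) x)).
  apply: (chS).
  - by rewrite /slice; definable.
  - move=> s t; case: (chX s t) => H; [left|right] => x [a [b [ab abX]]];
    by exists a, b; split=> // y ? ?; apply/H/abX.
  apply: fat_sub (fat_slice fX) => x; apply: (@fat1_chain (fun t => slice (X t) x)).
    by rewrite /slice; definable.
  by move=> s t; case: (chX s t) => H; [left|right] => y; apply: H.
by exists t; apply: fat_of_slice.
Qed.

Lemma fat_or n (A B : 'rV[R]_n -> Prop) :
  dpred S A -> dpred S B -> fat (fun x => A x \/ B x) -> fat A \/ fat B.
Proof. by have [H _] := fat_stable n; apply: H. Qed.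

Lemma fat_chain n (X : R -> 'rV[R]_n -> Prop) : defR S X -> chain X ->
  fat (fun y => exists t, X t y) -> exists t, fat (X t).
Proof. by have [_ H] := fat_stable n; apply: H. Qed.

End Fat.

(** * Relations between manifolds *)

Section Limit.
Variables (R : rcfType) (S : ostructure R).

(** The coordinates of [y] are confined one after another, each by [fat_localize1]. *)
Lemma fat_localize n m (Z : 'rV[R]_n -> 'rV[R]_m -> Prop) (d : R) :
  def2 S Z -> 0 < d -> fat (fun x => exists y, Z x y) ->
  exists c, fat (fun x => exists y, Z x y /\ box c d y).
Proof.
move=> dZ d0 fZ.
suff H j : (j <= m)%N -> exists c : 'rV[R]_m, fat (fun x => exists y, Z x y /\
    forall i : 'I_m, (i < j)%N -> c ord0 i - d < y ord0 i /\ y ord0 i < c ord0 i + d).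
  have [c fc] := H m (leqnn m).
  exists c; apply: fat_sub fc => x [y [Zxy yc]]; exists y; split=> // i.
  exact: yc.
elim: j => [_|j IH jm].
  by exists 0; apply: fat_sub fZ => x [y Zxy]; exists y.
have [c fc] := IH (ltnW jm); pose k := Ordinal jm.
pose Y s x := exists y, (Z x y /\ forall i : 'I_m, (i < j)%N ->
  c ord0 i - d < y ord0 i /\ y ord0 i < c ord0 i + d) /\ y ord0 k = s.
have dY : defR S Y by rewrite /Y; definable.
have [orS chS] := fat_stable S n.
have [|s fs] := fat_localize1 orS chS dY d0.
  by apply: fat_sub fc => x [y [Zxy yc]]; exists (y ord0 k), y.
exists (\row_i if i == k then s else c ord0 i).
apply: fat_sub fs => x [s' [s1 s2 [y [[Zxy yc] yk]]]]; exists y; split=> // i.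
rewrite ltnS mxE; case: eqVneq => [-> _|ik]; first by rewrite yk.
rewrite leq_eqVlt => /orP[/eqP ij|/yc//].
by case/eqP: ik; apply/val_inj.
Qed.

Lemma fat_limit_point n m (Z : 'rV[R]_n -> 'rV[R]_m -> Prop) :
  def2 S Z -> fat (fun x => exists y, Z x y) ->
  exists x y, Z x y /\
    forall d : R, 0 < d -> fat (fun x' => exists y', Z x' y' /\ box y d y').
Proof.
move=> dZ fZ; apply: contrapT => nZ.
(* The pairs of [Z] for which radius [d] already witnesses failure. These sets shrink as [d] grows,
   hence form a chain, and under the assumption [nZ] they exhaust [Z]. *)
pose W (d : R) x y := (0 < d) /\ Z x y /\ ~ fat (fun x' => exists y', Z x' y' /\ box y d y').
have [|||d fd] := @fat_chain _ S _ (fun d x => exists y, W d x y).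
- by rewrite /W; definable.
- suff W_anti s t x : s <= t -> 0 < s -> (exists y, W t x y) -> exists y, W s x y.
    move=> s t; have [st|ts] := leP s t.
      have [s0|s0] := ltP 0 s; first by right=> x; apply: W_anti.
      by left=> x [y [? _]]; lra.
    have [t0|t0] := ltP 0 t; first by left=> x; apply: W_anti => //; lra.
    by right=> x [y [? _]]; lra.
  move=> st s0 [y [t0 [Zxy nf]]]; exists y; split=> //; split=> //.
  apply: contra_not nf; apply: fat_sub => x' [y' [Zx' b]]; exists y'; split=> // i.
  by have [? ?] := b i; split; lra.
- apply: fat_sub fZ => x [y Zxy]; apply: contrapT => nW; apply: nZ.
  exists x, y; split=> // d d0; apply: contrapT => nf; apply: nW.
  by exists d, y.
have fat_ex (A : 'rV[R]_n -> Prop) : fat A -> exists x, A x.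
  by move=> [c [r [r0 cA]]]; exists c; apply: cA => i; split; lra.
have [x [y [d0 _]]] := fat_ex _ fd.
have d2 : 0 < d / 2 by lra.
have dW : def2 S (W d) by rewrite /W; definable.
(* Two points in one box of radius [d / 2] differ by less than [d] in each coordinate, so the box
   around [c] lies in the box of radius [d] around [y1], whose preimage was nonfat. *)
have [c fc] := fat_localize dW d2 fd.
have [x1 [y1 [[_ [_ nf]] b1]]] := fat_ex _ fc.
apply: nf; apply: fat_sub fc => x' [y' [[_ [Zx' _]] b']]; exists y'; split=> // i.
by have [? ?] := b1 i; have [? ?] := b' i; split; lra.
Qed.

Lemma fat_exists_seq n (I : eqType) (s : seq I) (A : I -> 'rV[R]_n -> Prop) :
  (forall i, dpred S (A i)) -> fat (fun x => exists i, i \in s /\ A i x) ->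
  exists i, fat (A i).
Proof.
move=> dA; elim: s => [|i s IH].
  move=> [c [r [r0 cA]]]; have [|i []//] := cA c.
  by move=> i; split; lra.
move=> f; have [||//|fi|fs] := @fat_or _ S _ (A i) (fun x => exists j, j \in s /\ A j x).
- exact: dA.
- elim: s {IH f} => [|j s IH].
    by apply: dpred_ext (dpred_const S _ False) => x; split=> // -[j []].
  apply: dpred_ext (dpred_or (dA j) IH) => x; split.
    move=> [Aj|[k [ks Ak]]]; first by exists j; rewrite mem_head.
    by exists k; rewrite in_cons ks orbT.
  move=> [k []]; rewrite in_cons => /orP[/eqP->|ks] Ak; first by left.
  by right; exists k.
- apply: fat_sub f => x [j []]; rewrite in_cons => /orP[/eqP->|js] Aj.
    by left.
  by right; exists j.
- by exists i.
- exact: IH.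
Qed.

(** Balls of row vectors are taken entrywise, hence are boxes. *)
Lemma open_boxP n (A : set 'rV[R]_n) :
  open A <-> forall x, A x -> exists2 r : R, 0 < r & forall y, box x r y -> A y.
Proof.
have ballE (x : 'rV[R]_n) r y : 0 < r -> ball x r y <-> box x r y.
  move=> r0; split.
    move=> [_ H] i; have : `|x ord0 i - y ord0 i| < r := H ord0 i.
    by rewrite ltr_norml => /andP[? ?]; split; lra.
  move=> H; split=> // i j; rewrite (ord1 i); suff : `|x ord0 j - y ord0 j| < r by [].
  rewrite ltr_norml.
  by have [? ?] := H j; apply/andP; split; lra.
rewrite openE; split=> [oA x /oA/nbhs_ballP[r /= r0 rA]|H x /H[r r0 rA]].
  by exists r => // y /ballE -/(_ r0); apply: rA.
by apply/nbhs_ballP; exists r => //= y /(ballE _ _ _ r0); apply: rA.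
Qed.

Lemma open_box n (c : 'rV[R]_n) (r : R) : open (box c r).
Proof.
apply/open_boxP => x xc.
pose f i := Num.min (x ord0 i - (c ord0 i - r)) (c ord0 i + r - x ord0 i).
have f0 i : 0 < f i by have [? ?] := xc i; rewrite lt_min; apply/andP; split; lra.
have [e e0 ef] : exists2 e, 0 < e & forall i, e <= f i.
  suff [e e0 ef] : exists2 e, 0 < e & forall i, i \in enum 'I_n -> e <= f i.
    by exists e => // i; apply: ef; rewrite mem_enum.
  elim: (enum 'I_n) => [|i s [e e0 ef]]; first by exists 1 => //; lra.
  exists (Num.min (f i) e); first by rewrite lt_min f0.
  move=> j; rewrite in_cons ge_min => /orP[/eqP->|/ef->]; first by rewrite lexx.
  by rewrite orbT.
exists e => // y yx i; have [? ?] := yx i; have := ef i; rewrite le_min => /andP[? ?].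
by split; lra.
Qed.

Lemma def2_graph n m (X : set 'rV[R]_n) (f : 'rV[R]_n -> 'rV[R]_m) :
  definable_fun S X f -> def2 S (fun x y => X x /\ y = f x).
Proof.
apply: dpred_ext => z; split=> [[x [Xx ->]]|[Xz fz]].
  by rewrite row_mxKl row_mxKr.
by exists (lsubmx z); split=> //; rewrite -fz hsubmxK.
Qed.

(** Carries [fat_limit_point] through charts. It produces the good point [g0] from the graph of
    [iota], read in either direction. *)
Lemma manifold_limit_point n k (X : set 'rV[R]_n) (Y : set 'rV[R]_k) opnX opnY a b
    (D : 'rV[R]_n -> 'rV[R]_k -> Prop) :
  def_manifold S X opnX a -> def_manifold S Y opnY b -> def2 S D ->
  X !=set0 -> (forall x, X x -> exists2 y, Y y & D x y) ->
  exists2 y, Y y & forall N, opnY N -> N y ->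
    exists O, [/\ opnX O, O !=set0 & forall x, O x -> exists2 y', N y' & D x y'].
Proof.
move=> [_ topX [p [U [phi [XU chU]]]]] [_ topY [q [V [psi [YV chV]]]]] dD [x0 Xx0] totD.
have [i _ Uix0] : (\bigcup_(i in setT) U i) x0 by rewrite -XU.
have [opnU _ /def2_graph dphi [phi_inj open_phi phiP]] := chU i.
pose gphi x w := U i x /\ w = phi i x.
pose gpsi j y v := V j y /\ v = psi j y.
have dgpsi j : def2 S (gpsi j).
  by have [_ _ /def2_graph] := chV j.
have dgphi : def2 S gphi by [].
(* [D] in the coordinates of [U i] and [V j]. By totality the domains of the finitely many [Z j]
   cover the image of [U i], so one of them is fat. *)
pose Z j w v := exists x y, [/\ gphi x w, gpsi j y v & D x y].
have dZ j : def2 S (Z j).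
  apply: (@dpred_ext _ _ _ (fun z : 'rV_(a + b) => exists x y,
    gphi x (lsubmx z) /\ gpsi j y (rsubmx z) /\ D x y)).
    move=> z; split=> -[x [y]]; first by move=> [? [? ?]]; exists x, y.
    by move=> [? ? ?]; exists x, y.
  have := dgpsi j; move: (gpsi j) => G dG; move: gphi dgphi {dphi Z} => H dH.
  by definable.
have UX x : U i x -> X x by rewrite XU => Ux; exists i.
have [j fj] : exists j, fat (fun w => exists v, Z j w v).
  apply: (@fat_exists_seq _ _ (enum 'I_q)).
    by move=> j; have := dZ j; move: (Z j) => G dG; definable.
  have /open_boxP/(_ (phi i x0)) [] := open_phi; first by exists x0.
  move=> r r0 rU; exists (phi i x0), r; split=> // w /rU[x Ux <-].
  have [y Yy Dxy] := totD x (UX _ Ux).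
  have [j _ Vjy] : (\bigcup_(i in setT) V i) y by rewrite -YV.
  by exists j; split; [rewrite mem_enum|exists (psi j y), x, y].
have [w [v [[x [y [_ [Vy ->] _]]] lim]]] := fat_limit_point (dZ j) fj.
have [opnV _ _ [psi_inj open_psi psiP]] := chV j.
exists y; first by rewrite YV; exists j.
move=> N oN Ny.
have NVV : N `&` V j `<=` V j by move=> ? [].
have oNV : opnY (N `&` V j) by have [_ _ _ + _] := topY; apply.
have /open_boxP/(_ (psi j y)) [] := proj1 (psiP _ NVV) oNV; first by exists y.
move=> d d0 dN; have [c [r [r0 cr]]] := lim d d0.
have boxU w' : box c r w' -> exists2 x', U i x' & phi i x' = w'.
  by move=> /cr[v' [[x' [y' [[Ux' ->] _ _]]] _]]; exists x'.
(* By [boxU] the box lies in the image of the chart, so the image of [O] is the whole box and [O] is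
   open. *)
pose O := U i `&` phi i @^-1` box c r.
have OU : O `<=` U i by move=> ? [].
exists O; split.
- apply/(phiP _ OU); suff -> : phi i @` O = box c r by apply: open_box.
  apply/seteqP; split=> [_ [x' [_ bx'] <-]//|w' bw'].
  by have [x' Ux' E] := boxU w' bw'; exists x' => //; split=> //=; rewrite E.
- have [|x' Ux' E] := boxU c; first by move=> l; split; lra.
  by exists x'; split=> //=; rewrite E => l; split; lra.
(* Points are recovered only through their coordinates; injectivity of the two charts identifies
   [x''] with [x'] and [y''] with [y']. *)
move=> x' [Ux' /= /cr[v' [[x'' [y' [[Ux'' E] [Vy' ->] Dxy']]] /dN[y'' [Ny'' Vy''] E']]]].
exists y'; first by rewrite -(psi_inj y'' y').
by rewrite (phi_inj x' x'').
Qed.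

End Limit.

(** * The quotient *)

Lemma topology_nbhsP (R : rcfType) n (X : set 'rV[R]_n) opn (A : set 'rV[R]_n) :
  is_topology X opn ->
  (forall x, A x -> exists B, [/\ opn B, B x & B `<=` A]) -> opn A.
Proof.
move=> [_ _ _ _ opnU] nbhA.
have -> : A = \bigcup_(B in [set B | opn B /\ B `<=` A]) B.
  apply/seteqP; split=> [x /nbhA[B [oB Bx BA]]|x [B [_ BA] /BA//]].
  by exists B.
by apply: opnU => B [].
Qed.

Lemma def2_swap (R : rcfType) (S : ostructure R) n m
    (D : 'rV[R]_n -> 'rV[R]_m -> Prop) :
  def2 S D -> def2 S (fun y x => D x y).
Proof. by move=> dD; definable. Qed.

Section Quotient.
Variables (R : rcfType) (S : ostructure R) (n k : nat).
Variables (G H : set 'rV[R]_n) (mul : 'rV[R]_n -> 'rV[R]_n -> 'rV[R]_n).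
Variables (inv : 'rV[R]_n -> 'rV[R]_n) (e : 'rV[R]_n) (sigma : set (set 'rV[R]_n)).
Variables (iota : 'rV[R]_n -> 'rV[R]_k).
Hypothesis defG : def_group S G mul inv e.
Hypotheses (topG : group_topology S G mul inv sigma).
Hypotheses (quotH : quot_map S G H mul inv iota).

Let Ge : G e. Proof. by have [_ _ _ []] := defG. Qed.
Let GM g h : G g -> G h -> G (mul g h).
Proof. by have [_ _ _ [_ + _] _] := defG; apply. Qed.
Let GV g : G g -> G (inv g).
Proof. by have [_ _ _ [_ _ +] _] := defG; apply. Qed.
Let mulA g h l : G g -> G h -> G l -> mul (mul g h) l = mul g (mul h l).
Proof. by have [_ _ _ _ [+ _ _]] := defG; apply. Qed.
Let mul1 g : G g -> mul e g = g.
Proof. by have [_ _ _ _ [_ + _]] := defG => /[apply] -[]. Qed.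
Let mule g : G g -> mul g e = g.
Proof. by have [_ _ _ _ [_ + _]] := defG => /[apply] -[]. Qed.
Let mulV g : G g -> mul (inv g) g = e.
Proof. by have [_ _ _ _ [_ _ +]] := defG => /[apply] -[]. Qed.
Let mulgV g : G g -> mul g (inv g) = e.
Proof. by have [_ _ _ _ [_ _ +]] := defG => /[apply] -[]. Qed.
Let mulKV g h : G g -> G h -> mul (inv g) (mul g h) = h.
Proof. by move=> Gg Gh; rewrite -mulA ?mulV ?mul1 //; apply: GV. Qed.
Let mulVK g h : G g -> G h -> mul g (mul (inv g) h) = h.
Proof. by move=> Gg Gh; rewrite -mulA ?mulgV ?mul1 //; apply: GV. Qed.

(** Translation by [a g^-1] moves points near [g] to points near [a]; translation by [g a^-1] brings
    them back. *)
Let mul_back a g h : G a -> G g -> G h ->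
  mul (mul g (inv a)) (mul (mul a (inv g)) h) = h.
Proof.
move=> Ga Gg Gh; have [Gai Ggi] := (GV Ga, GV Gg).
by rewrite !mulA ?mulKV ?mulVK //; do ?apply: GM.
Qed.

Let iota_mul g a b : G g -> G a -> G b -> iota a = iota b ->
  iota (mul g a) = iota (mul g b).
Proof.
have [_ iotaP] := quotH; move=> Gg Ga Gb /(iotaP _ _ Ga Gb) Hab.
apply/(iotaP _ _ (GM Gg Ga) (GM Gg Gb)).
have Gab := GM (GV Ga) Gb.
have -> : mul g b = mul (mul g a) (mul (inv a) b) by rewrite mulA // mulVK.
by rewrite mulKV //; apply: GM.
Qed.

Let subG A : sigma A -> A `<=` G.
Proof. by have [[d [_ [_ _ + _ _] _]] _] := topG; apply. Qed.

Let dgraph : def2 S (fun g x => G g /\ x = iota g).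
Proof. by have [/def2_graph] := quotH. Qed.

(** * Comparison of the topologies on the quotient *)

Lemma quot_continuous_sub tau :
  action_continuous G mul iota sigma tau -> (forall V, tau V -> V `<=` iota @` G) ->
  tau `<=` quot_top G iota sigma.
Proof.
move=> act tauS V oV; split; first exact: tauS.
have [[d [_ topS _]] _] := topG.
apply: (topology_nbhsP topS) => g [Gg Vg].
have [|A [B [oA oB Ag Be AB]]] := act g e Gg Ge V oV; first by rewrite mule.
exists A; split=> // a Aa; have Ga := subG oA Aa.
by split=> //; rewrite -(mule Ga); apply: AB.
Qed.

Lemma quot_top_sub tau d : def_manifold S (iota @` G) tau d ->
  action_continuous G mul iota sigma tau -> quot_top G iota sigma `<=` tau.
Proof.
move=> mX act U [US oU].
have [[m mG] [mulC invC]] := topG.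
have [_ topT _] := mX.
(* The graph is read from G/H to G: the image of each neighbourhood of [g0] contains a nonempty
   [tau]-open set. *)
have [||x|g0 Gg0 limg0] := manifold_limit_point (D := fun x g => G g /\ x = iota g) mX mG.
- exact: def2_swap dgraph.
- by exists (iota e), e.
- by move=> [g Gg <-]; exists g.
apply: (topology_nbhsP topT) => x Ux; have [g Gg gx] := US x Ux.
set W := [set g | G g /\ U (iota g)] in oU.
have Wg : W (mul (mul g (inv g0)) g0).
  by rewrite mulA ?mulV ?mule //; [split=> //; rewrite gx|exact: GV].
(* The neighbourhoods are chosen so that [g a^-1 b] stays in [W] for all [a] in [A4] and [b] in
   [B]. *)
have [A1 [B [oA1 oB A1g Bg0 AB]]] := mulC _ _ (GM Gg (GV Gg0)) Gg0 W oU Wg.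
have [A2 [A3 [oA2 oA3 A2g A3g0 A23]]] := mulC _ _ Gg (GV Gg0) A1 oA1 A1g.
have [A4 [oA4 A4g0 A4i]] := invC _ Gg0 A3 oA3 A3g0.
have [|O [oO [x0 Ox0] OA]] := limg0 (A4 `&` B) _ (conj A4g0 Bg0).
  by have [_ [_ _ _ + _] _] := mG; apply.
have [a [A4a Ba] [Ga ia]] := OA x0 Ox0.
have Gag : G (mul a (inv g)) := GM Ga (GV Gg).
have mulag : mul (mul a (inv g)) g = a by rewrite mulA ?mulV ?mule //; exact: GV.
(* Translation by [a g^-1] sends [gH] to [aH], a point of [O], hence a whole neighbourhood [C2] of
   [gH] into [O]. *)
have [|C1 [C2 [oC1 oC2 C1g C2g CO]]] := act _ _ Gag Gg O oO.
  by rewrite mulag -ia.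
exists C2; split=> //; first by rewrite -gx.
have [_ _ C2S _ _] := topT.
move=> y C2y; have [h Gh hy] := C2S _ oC2 _ C2y.
(* The translate of [y] lies in [O], so it lifts to some [b] in [B]; then [g a^-1 b] lies in [W] and
   represents [y]. *)
have [|b [_ Bb] [Gb ib]] := OA (iota (mul (mul a (inv g)) h)).
  by apply: CO => //; rewrite hy.
have [_] : W (mul (mul g (inv a)) b).
  by apply: AB => //; apply: A23 => //; apply: A4i.
suff -> : iota (mul (mul g (inv a)) b) = y by [].
have Gga : G (mul g (inv a)) := GM Gg (GV Ga).
rewrite -hy -(iota_mul Gga _ Gb ib); last exact: GM.
by congr iota; apply: mul_back.
Qed.

(** The action is the multiplication of G/H with [iota] applied to the first argument, so only
    continuity of [iota] is at stake. *)
Lemma quot_topgroup_action mu d : def_manifold S (iota @` G) mu d ->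
  quot_topgroup G mul inv iota mu -> action_continuous G mul iota sigma mu.
Proof.
move=> mX [qmul qinv].
have [[m mG] [mulC _]] := topG.
have [_ topS _] := mG.
have [_ topM _] := mX.
(* The graph is now read from G to G/H: each [mu]-neighbourhood of [iota g0] contains the image of a
   nonempty [sigma]-open set. *)
have [|g Gg|_ [g0 Gg0 <-] limg0] := manifold_limit_point (D := fun g x => G g /\ x = iota g) mG mX dgraph.
- by exists e.
- by exists (iota g) => //; exists g.
(* Mirror image of [quot_top_sub]: [A1] to [A4] and [B] now live in G/H, while [O] and the
   translation by [a g^-1] live in G. *)
have cont V : mu V -> sigma [set g | G g /\ V (iota g)].
  move=> oV; apply: (topology_nbhsP topS) => g [Gg Vg].
  have Vg' : V (iota (mul (mul g (inv g0)) g0)).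
    by rewrite mulA ?mulV ?mule //; exact: GV.
  have [A1 [B [oA1 oB A1g Bg0 AB]]] := qmul _ _ (GM Gg (GV Gg0)) Gg0 V oV Vg'.
  have [A2 [A3 [oA2 oA3 A2g A3g0 A23]]] := qmul _ _ Gg (GV Gg0) A1 oA1 A1g.
  have [A4 [oA4 A4g0 A4i]] := qinv _ Gg0 A3 oA3 A3g0.
  have [|O [oO [a Oa] OA]] := limg0 (A4 `&` B) _ (conj A4g0 Bg0).
    by have [_ _ _ + _] := topM; apply.
  have [x [A4a _] [Ga ia]] := OA a Oa; rewrite ia in A4a.
  have Gag : G (mul a (inv g)) := GM Ga (GV Gg).
  have mulag : mul (mul a (inv g)) g = a by rewrite mulA ?mulV ?mule //; exact: GV.
  have [|C1 [C2 [oC1 oC2 C1g C2g CO]]] := mulC _ _ Gag Gg O oO; first by rewrite mulag.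
  exists C2; split=> // h C2h; have Gh := subG oC2 C2h; split=> //.
  have [y [_ Bb] [Gb ib]] := OA _ (CO _ _ C1g C2h); rewrite ib in Bb.
  have Gga : G (mul g (inv a)) := GM Gg (GV Ga).
  suff -> : h = mul (mul g (inv a)) (mul (mul a (inv g)) h).
    apply: AB => //.
    by apply: A23 => //; [exact: GV|exact: A4i].
  exact/esym/mul_back.
move=> g g' Gg Gg' V oV Vgg'.
have [A [B [oA oB Ag Bg' AB]]] := qmul g g' Gg Gg' V oV Vgg'.
exists [set a | G a /\ A (iota a)], B; split=> //; first exact: cont.
by move=> a b [Ga Aa] Gb Bb; apply: AB.
Qed.

End Quotient.

Theorem theorem4p3 (R : rcfType) (S : ostructure R) (n k : nat)
    (G H : set 'rV[R]_n) (mul : 'rV[R]_n -> 'rV[R]_n -> 'rV[R]_n)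
    (inv : 'rV[R]_n -> 'rV[R]_n) (e : 'rV[R]_n) (sigma : set (set 'rV[R]_n))
    (iota : 'rV[R]_n -> 'rV[R]_k) (tau : set (set 'rV[R]_k)) :
  def_group S G mul inv e ->
  def_subgroup S G H mul inv e ->
  group_topology S G mul inv sigma ->
  quot_map S G H mul inv iota ->
  (exists d, def_manifold S (iota @` G) tau d) ->
  action_continuous G mul iota sigma tau ->
  tau = quot_top G iota sigma /\
  (normal_subgroup G H mul inv ->
   forall mu : set (set 'rV[R]_k),
     (exists d, def_manifold S (iota @` G) mu d) ->
     quot_topgroup G mul inv iota mu ->
     mu = quot_top G iota sigma).
Proof.
move=> defG _ topG quotH.
(* Stated for an arbitrary [rho], so as to serve for [tau] and for [mu]. *)
have unique rho : (exists d, def_manifold S (iota @` G) rho d) ->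
    action_continuous G mul iota sigma rho -> rho = quot_top G iota sigma.
  move=> [d mX] act; have [_ [_ _ rhoS _ _] _] := mX.
  apply/seteqP; split; first exact: (quot_continuous_sub defG topG).
  exact: (quot_top_sub defG topG quotH mX).
move=> manT actT; split; first exact: unique.
move=> _ mu manM tgM; apply: unique => //.
by case: manM => d mX; apply: (quot_topgroup_action defG topG quotH mX).
Qed.
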